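(* Let $f:\mathbb{R}^d\to\mathbb{R}$ be differentiable, $L$-smooth (i.e. $\|\nabla f(x)-\nabla f(y)\|\le L\|x-y\|$ for all $x,y\in\mathbb{R}^d$), and bounded from below by $f^*\in\mathbb{R}$. Let $g$ be a gradient estimator for which there are constants $A,B,C\ge0$ such that for every $x\in\mathbb{R}^d$ $$\langle\nabla f(x),\mathbb{E}[g(x)]\rangle\ge\|\nabla f(x)\|^2,\qquad \mathbb{E}[\|g(x)\|^2]\le 2A(f(x)-f^* )+B\|\nabla f(x)\|^2+C.$$ Let $\delta^0=f(x^0)-f^*$ and fix $\varepsilon>0$. Choose the stepsize $\gamma=\min\left\{\frac{1}{\sqrt{LAT}},\frac{1}{LB},\frac{\varepsilon^2}{2LC}\right\}$. Then, if $$T\ge\frac{12\delta^0L}{\varepsilon^2}\max\left\{B,\frac{12\delta^0A}{\varepsilon^2},\frac{2C}{\varepsilon^2}\right\},$$ the iterates of BiasedSGD satisfy $$\min_{0\le t\le T-1}\mathbb{E}\left[\|\nabla f(x^t)\|\right]\le\varepsilon.$$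
   Context: A gradient estimator is a (possibly random, possibly biased) mapping $g:\mathbb{R}^d\to\mathbb{R}^d$. BiasedSGD with starting point $x^0\in\mathbb{R}^d$ and stepsize $\gamma>0$ is the iteration $x^{t+1}=x^t-\gamma g^t$, $t=0,1,2,\dots$, where $g^t=g(x^t)$ is a fresh realization of the estimator at $x^t$ (conditionally on $x^t$, $g^t$ has the law of $g(x)$ at $x=x^t$). $T\ge1$ is the number of iterations. $\mathbb{E}$ is expectation over the randomness of the algorithm, and $\|\cdot\|$ is the Euclidean norm. *)

(* Defs.v *)
From HB Require Import structures.
From mathcomp Require Import all_boot all_order all_algebra.
From mathcomp Require Import all_classical all_reals all_analysis.

Set Implicit Arguments.
Unset Strict Implicit.
Unset Printing Implicit Defensive.

Import Order.TTheory GRing.Theory Num.Theory.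
Import numFieldNormedType.Exports.

Local Open Scope classical_set_scope.
Local Open Scope ring_scope.

(* 'rV[R]_d carries its Borel sigma-algebra. *)
HB.instance Definition _ (R : realType) (m n : nat) :=
  Measurable.copy 'M[R]_(m, n)
    (g_sigma_algebraType (@open 'M[R]_(m, n))).

Section euclidean.
Context {R : realType} {d : nat}.
Implicit Types u v x : 'rV[R]_d.

Definition dotv u v : R := \sum_(i < d) u 0 i * v 0 i.

(* The library norm `|u| on matrices is the sup norm. *)
Definition enorm u : R := Num.sqrt (dotv u u).

Definition grad (f : 'rV[R]_d -> R) x : 'rV[R]_d :=
  \row_(i < d) 'D_(delta_mx 0 i) f x.

Definition smooth (L : R) (f : 'rV[R]_d -> R) : Prop :=
  (forall x, differentiable f x) /\
  (forall x y, enorm (grad f x - grad f y) <= L * enorm (x - y)).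

End euclidean.

(* A random map g : R^d -> R^d is given by its laws: the probability kernel
   sending x to the distribution of g(x). *)
Notation estimator R d := (R.-pker 'rV[R]_d ~> 'rV[R]_d).

Section estimator.
Context {R : realType} {d : nat} (g : estimator R d).
Implicit Types x : 'rV[R]_d.

(* E[g(x)], coordinatewise; the integrals are meaningful as soon as the second
   moment below is finite. *)
Definition mean x : 'rV[R]_d := \row_(i < d) \int[g x]_y y 0 i.

Definition second_moment x : \bar R := (\int[g x]_y (enorm y ^+ 2)%:E)%E.

End estimator.

Section algorithm.
Context {R : realType} {d : nat} {d' : measure_display}
  {Omega : measurableType d'} (P : probability Omega R).
Implicit Types X Y : {RV P >-> 'rV[R]_d}.

(* Conditionally on X, Y has law k x at x = X: the joint law of (X, Y)
   disintegrates as P(X in U, Y in V) = E[1_{X in U} k(X, V)]. *)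
Definition conditional_law X Y (k : estimator R d) : Prop :=
  forall U V : set 'rV[R]_d, measurable U -> measurable V ->
    P (X @^-1` U `&` Y @^-1` V) = (\int[P]_(w in X @^-1` U) k (X w) V)%E.

Definition BiasedSGD (g : estimator R d) (gamma : R) (x0 : 'rV[R]_d)
    (x gt : nat -> {RV P >-> 'rV[R]_d}) : Prop :=
  [/\ forall w, x 0%N w = x0,
      forall t w, x t.+1 w = x t w - gamma *: gt t w
    & forall t, conditional_law (x t) (gt t) g].

End algorithm.

(* min {1/sqrt(LAT), 1/(LB), eps^2/(2LC)}, taken in \bar R, where 1/0 = +oo:
   a term whose denominator vanishes imposes no restriction, and the value +oo
   (all denominators vanish) leaves the positive stepsize unrestricted. *)
Definition stepsize {R : realType} (L A B C eps : R) (T : nat) : \bar R :=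
  (mine (1 / (Num.sqrt (L * A * T%:R))%:E)
    (mine (1 / (L * B)%:E) ((eps ^+ 2)%:E / (2 * L * C)%:E)))%E.

(* Main.v *)
Require Import Defs.
From HB Require Import structures.
From mathcomp Require Import all_boot all_order all_algebra.
From mathcomp Require Import all_classical all_reals all_analysis.
From mathcomp Require Import measurable_realfun ring lra.

Import Order.TTheory GRing.Theory Num.Theory.
Import numFieldNormedType.Exports.

Local Open Scope classical_set_scope.
Local Open Scope ring_scope.

(* Write D_t = E[f(x^t) - f^*], R_t = E[|grad f(x^t)|^2] and
   a = L A gamma^2, c = L C gamma^2 / 2. The descent inequality, conditioned on
   x^t, gives D_{t+1} + (gamma/2) R_t <= (1 + a) D_t + c. If R_t > eps^2 for all
   t < T, then unrolling the recursion with (1 + a)^T <= 3, c <= gamma eps^2 / 4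
   and 12 delta^0 <= T gamma eps^2 contradicts D_T >= 0. Hence
   R_t <= eps^2 for some t < T, and E[|grad f(x^t)|] <= eps. If all three terms
   of the stepsize are infinite, or if L <= 0, then grad f = 0. *)

(** * Euclidean geometry and the descent inequality *)

Section dot_product.
Context {R : realType} {d : nat}.
Implicit Types u v w x : 'rV[R]_d.

Lemma dotvC u v : dotv u v = dotv v u.
Proof. by apply: eq_bigr => i _; rewrite mulrC. Qed.

Lemma dotvDl u v w : dotv (u + v) w = dotv u w + dotv v w.
Proof.
by rewrite /dotv -big_split; apply: eq_bigr => i _; rewrite mxE mulrDl.
Qed.

Lemma dotvZl a u v : dotv (a *: u) v = a * dotv u v.
Proof.
by rewrite /dotv mulr_sumr; apply: eq_bigr => i _; rewrite mxE mulrA.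
Qed.

Lemma dotvNl u v : dotv (- u) v = - dotv u v.
Proof. by rewrite -scaleN1r dotvZl mulN1r. Qed.

Lemma dotvDr u v w : dotv w (u + v) = dotv w u + dotv w v.
Proof. by rewrite !(dotvC w) dotvDl. Qed.

Lemma dotvZr a u v : dotv v (a *: u) = a * dotv v u.
Proof. by rewrite !(dotvC v) dotvZl. Qed.

Lemma dotvNr u v : dotv v (- u) = - dotv v u.
Proof. by rewrite !(dotvC v) dotvNl. Qed.

Lemma dotvv_ge0 u : 0 <= dotv u u.
Proof. by apply: sumr_ge0 => i _; rewrite -expr2 sqr_ge0. Qed.

Lemma enorm_ge0 u : 0 <= enorm u. Proof. exact: sqrtr_ge0. Qed.

Lemma sqr_enorm u : enorm u ^+ 2 = dotv u u.
Proof. by rewrite sqr_sqrtr// dotvv_ge0. Qed.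

Lemma enormZ a u : enorm (a *: u) = `|a| * enorm u.
Proof.
by rewrite /enorm dotvZl dotvZr mulrA -expr2 sqrtrM ?sqr_ge0// sqrtr_sqr.
Qed.

Lemma sqr_coord_le_enorm u i : u 0 i ^+ 2 <= enorm u ^+ 2.
Proof.
rewrite sqr_enorm /dotv (bigD1 i)//= expr2 lerDl.
by apply: sumr_ge0 => j _; rewrite -expr2 sqr_ge0.
Qed.

Lemma enorm0 : enorm (0 : 'rV[R]_d) = 0.
Proof. by rewrite /enorm /dotv big1 ?sqrtr0// => i _; rewrite mxE mul0r. Qed.

Lemma sqr_enorm_le0 u : enorm u ^+ 2 <= 0 -> u = 0.
Proof.
move=> u0; apply/rowP => i; apply/eqP; rewrite [X in _ == X]mxE -sqrf_eq0 eq_le.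
by rewrite sqr_ge0 andbT (le_trans (sqr_coord_le_enorm u i)).
Qed.

Lemma coord_le_enorm u i : `|u 0 i| <= enorm u.
Proof.
rewrite -(@ler_pXn2r _ 2) ?nnegrE ?enorm_ge0// real_normK ?num_real//.
exact: sqr_coord_le_enorm.
Qed.

(* AM-GM: [2 u_i v_i <= u_i^2 / c + c v_i^2]. *)
Lemma dotv_le_sqr c u v : 0 < c -> enorm u <= c * enorm v ->
  dotv u v <= c * enorm v ^+ 2.
Proof.
move=> c0 uv.
have uv2 : dotv u u <= c ^+ 2 * dotv v v.
  by rewrite -!sqr_enorm -exprMn ler_pXn2r ?nnegrE ?mulr_ge0 ?enorm_ge0// ltW.
have : 0 <= dotv (u - c *: v) (u - c *: v) by exact: dotvv_ge0.
rewrite dotvDl !dotvDr !(dotvNl, dotvNr, dotvZl, dotvZr) (dotvC v u) => h.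
rewrite sqr_enorm -(ler_pM2l c0); lra.
Qed.

End dot_product.

(** * Gradients of smooth functions *)

Section smooth_functions.
Context {R : realType} {d : nat}.
Implicit Types (f : 'rV[R]_d -> R) (x y v h : 'rV[R]_d) (L : R).

Lemma derive_grad f x v : differentiable f x -> 'D_v f x = dotv (grad f x) v.
Proof.
move=> df; rewrite deriveE// [in LHS](row_sum_delta v) linear_sum.
by apply: eq_bigr => i _; rewrite linearZ/= mxE deriveE// mulrC.
Qed.

(** The difference quotients in [s] coincide with those of the directional derivative of [f] along
    [h] at [x + s *: h]. *)
Lemma is_derive_line f x h (s : R) : differentiable f (x + s *: h) ->
  is_derive s 1 (fun s => f (x + s *: h)) (dotv (grad f (x + s *: h)) h).
Proof.
move=> df.
have quot : (fun t : R => t^-1 *: (f (x + (t *: 1 + s) *: h) - f (x + s *: h)))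
          = (fun t : R => t^-1 *: (f (t *: h + (x + s *: h)) - f (x + s *: h))).
  by apply/funext => t; rewrite scalerDl /= [t *: 1]mulr1 addrCA.
have := @diff_derivable _ _ _ _ _ h df => dh.
apply: DeriveDef.
  by rewrite /derivable /= quot.
by rewrite -derive_grad// /derive /= quot.
Qed.

Lemma smooth_le L L' f : L <= L' -> smooth L f -> smooth L' f.
Proof.
move=> LL' [df Lf]; split => // x y; rewrite (le_trans (Lf x y))//.
by rewrite ler_wpM2r// enorm_ge0.
Qed.

Lemma descent L f x h : 0 < L -> smooth L f ->
  f (x + h) <= f x + dotv (grad f x) h + L / 2 * enorm h ^+ 2.
Proof.
move=> L0 [df Lf].
(* The claim is [phi 1 <= phi 0]. The derivative of [phi] is nonpositive on the open unit interval
   by the Lipschitz bound and [dotv_le_sqr] with constant [s * L]. *)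
pose phi s := f (x + s *: h) - s * dotv (grad f x) h
  - s ^+ 2 * (L / 2 * enorm h ^+ 2).
have dphi (s : R) : is_derive s 1 phi (dotv (grad f (x + s *: h)) h
    - dotv (grad f x) h - s * (L * enorm h ^+ 2)).
  have ? := is_derive_line f x h s (df _).
  apply: is_derive_eq.
  rewrite /GRing.scale /= !mulr0; lra.
have : phi 1 <= phi 0.
  apply: (@ler0_derive1_le_cc _ phi 0 1); rewrite ?in_itv/= ?lexx ?ler01//.
  - by move=> s; rewrite in_itv/= => /andP[s0 _]; rewrite derive1E derive_val
      subr_le0 -dotvNl -dotvDl mulrA dotv_le_sqr ?mulr_gt0//
      (le_trans (Lf _ _))// addrAC subrr add0r enormZ gtr0_norm// mulrCA mulrA.
  - apply: continuous_subspaceT => s; apply: differentiable_continuous.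
    exact/derivable1_diffP.
rewrite /phi scale1r scale0r addr0; lra.
Qed.

(** A gradient step with stepsize [L^-1] lowers [f] by at least the squared gradient norm over
    [2 * L], and the value reached is still at least [m]. *)
Lemma sqr_grad_le L f m x : 0 < L -> smooth L f -> (forall y, m <= f y) ->
  enorm (grad f x) ^+ 2 <= 2 * L * (f x - m).
Proof.
move=> L0 sf mf.
have := le_trans (mf _) (descent L _ x (- L^-1 *: grad f x) L0 sf).
rewrite enormZ normrN gtr0_norm ?invr_gt0// dotvZr -sqr_enorm exprMn.
set q := enorm _ ^+ 2.
have -> : L / 2 * (L^-1 ^+ 2 * q) = L^-1 * q / 2 by field; rewrite gt_eqF.
have -> : q = L * (L^-1 * q) by rewrite mulrA divff ?mul1r// gt_eqF.
set r := L^-1 * q => h.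
suff : 0 <= f x - m - r / 2 by move=> h2; rewrite -subr_ge0; nra.
have Lr : L^-1 * (L * r) = r by rewrite mulrA mulVf ?mul1r// gt_eqF.
by rewrite mulNr Lr in h; lra.
Qed.

(** Here [f] is smooth with every positive constant, so [sqr_grad_le] makes the squared gradient
    norm arbitrarily small. *)
Lemma grad_smooth_le0 L f m x : L <= 0 -> smooth L f -> (forall y, m <= f y) ->
  grad f x = 0.
Proof.
move=> L0 sf mf; have mx := mf x.
apply: sqr_enorm_le0; apply/ler_addgt0Pl => e e0; rewrite addr0.
(* Chosen so that [2 * L' * (f x - m + 1) = e]; the added 1 keeps the denominator positive when
   [f x = m]. *)
pose L' := e / (2 * (f x - m + 1)).
have L'0 : 0 < L' by rewrite divr_gt0//; lra.
have sf' : smooth L' f by apply: smooth_le sf; rewrite (le_trans L0)// ltW.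
apply: le_trans (sqr_grad_le _ _ _ x L'0 sf' mf) _.
have -> : e = 2 * L' * (f x - m + 1) by rewrite /L'; field; lra.
by rewrite ler_wpM2l//; lra.
Qed.

End smooth_functions.

(** * Measurability and disintegration of the joint law *)

Section measurability.
Context {R : realType} {d : nat}.

Lemma continuous_rV_measurable (u : 'rV[R]_d -> R) :
  continuous u -> measurable_fun [set: 'rV[R]_d] u.
Proof.
move=> /continuousP cu; apply: (measurability _ (RGenOInfty.measurableE R)).
move=> _ [_ [a ->] <-]; rewrite setTI; apply: sub_sigma_algebra.
exact/cu/interval_open.
Qed.

Lemma measurable_coord (i : 'I_d) :
  measurable_fun [set: 'rV[R]_d] (fun y : 'rV[R]_d => y 0 i).
Proof. by apply: continuous_rV_measurable; exact: coord_continuous. Qed.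

Lemma measurable_dotv d' (T : measurableType d') (u v : T -> 'rV[R]_d) :
  (forall i, measurable_fun [set: T] (fun t => u t 0 i)) ->
  (forall i, measurable_fun [set: T] (fun t => v t 0 i)) ->
  measurable_fun [set: T] (fun t => dotv (u t) (v t)).
Proof. by move=> mu mv; apply: measurable_sum => i; exact: measurable_funM. Qed.

Lemma measurable_smooth (L : R) (f : 'rV[R]_d -> R) :
  smooth L f -> measurable_fun [set: 'rV[R]_d] f.
Proof.
move=> [df _]; apply: continuous_rV_measurable => x.
exact: differentiable_continuous.
Qed.

Lemma sqr_dist_continuous (y : 'rV[R]_d) :
  continuous (fun x : 'rV[R]_d => dotv (x - y) (x - y)).
Proof.
apply: continuous_big => [|i _ x]; first exact: add_continuous.
have ci : {for x, continuous (fun z : 'rV[R]_d => (z - y) 0 i)}.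
  have -> : (fun z : 'rV[R]_d => (z - y) 0 i) = (fun z => z 0 i - y 0 i).
    by apply/funext => z; rewrite !mxE.
  exact: (continuousB (@coord_continuous _ _ _ 0 i x)
    (@cst_continuous _ _ (y 0 i) x)).
exact: (continuousM ci ci).
Qed.

(** The topology on row vectors is that of the sup norm; this limit turns the Lipschitz bound,
    stated with [enorm], into continuity of the gradient. *)
Lemma enorm_cvg0 (y : 'rV[R]_d) : enorm (x - y) @[x --> y] --> (0 : R).
Proof.
have -> : 0 = Num.sqrt (dotv (y - y) (y - y)) :> R.
  by rewrite subrr /dotv big1 ?sqrtr0// => i _; rewrite mxE mul0r.
apply: (@cvg_comp _ _ _ (fun x => dotv (x - y) (x - y)) (@Num.sqrt R)).
  exact: sqr_dist_continuous.
exact: sqrt_continuous.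
Qed.

Lemma grad_coord_continuous (L : R) (f : 'rV[R]_d -> R) (i : 'I_d) :
  smooth L f -> continuous (fun x => grad f x 0 i).
Proof.
move=> [_ Lf] y; apply/(cvgrPdist_le (FF := nbhs_filter y)) => e e0 /=.
have : L * enorm (x - y) @[x --> y] --> L * 0.
  exact: (cvgMl_tmp (enorm_cvg0 y)).
rewrite mulr0 => /(cvgrPdist_le (FF := nbhs_filter y)) /(_ e e0) /=.
apply: filterS => x.
rewrite sub0r normrN; apply: le_trans.
rewrite (le_trans _ (ler_norm _))// (le_trans _ (Lf _ _))//.
by rewrite distrC (le_trans _ (coord_le_enorm _ i))// !mxE.
Qed.

Lemma measurable_grad_coord (L : R) (f : 'rV[R]_d -> R) (i : 'I_d) :
  smooth L f -> measurable_fun [set: 'rV[R]_d] (fun x => grad f x 0 i).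
Proof.
by move=> sf; exact: continuous_rV_measurable (grad_coord_continuous L f i sf).
Qed.

End measurability.

(** * Disintegration of the joint law of an iterate and its stochastic gradient *)

Section joint_law.
Context {R : realType} {d : nat} {d' : measure_display}
  {Omega : measurableType d'} (P : probability Omega R).
Variables (X Y : {RV P >-> 'rV[R]_d}) (g : estimator R d).
Local Notation V := 'rV[R]_d.

(* The constant kernel from [unit] lets [integral_kcomp], which is about the
   composition of two kernels, apply to the measure [P]. *)
Let const_law (_ : unit) : {measure set Omega -> \bar R} := P.

Let measurable_const_law U : measurable U ->
  measurable_fun [set: unit] (const_law ^~ U).
Proof. by move=> mU; exact: measurable_cst. Qed.

HB.instance Definition _ := isKernel.Build _ _ _ _ R const_law
  measurable_const_law.

Let const_law_setT u : const_law u [set: Omega] = 1%E.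
Proof. exact: probability_setT. Qed.

HB.instance Definition _ := Kernel_isProbability.Build _ _ _ _ R const_law
  const_law_setT.

Let pairX (u : unit * Omega) (y : V) : V * V := (X u.2, y).

Let measurable_pairX u : measurable_fun [set: V] (pairX u).
Proof. exact: measurable_fun_pair. Qed.

(** The law of [(X w, y)] with [y] drawn from [g (X w)]. Composed with [const_law], it gives the
    joint law that [conditional_law] prescribes. *)
Let pair_law (u : unit * Omega) : {measure set (V * V) -> \bar R}.
Proof.
unshelve refine (pushforward (g (X u.2)) (pairX u) : measure _ _).
exact: measurable_pairX.
Defined.

Let measurable_pair_law U : measurable U ->
  measurable_fun [set: unit * Omega] (pair_law ^~ U).
Proof.
move=> mU.
have -> : pair_law ^~ U = (fun x => g x (xsection U x)) \o X \o snd.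
  by apply/funext => u; rewrite /pair_law/= /pushforward xsectionE.
apply: measurableT_comp => //; apply: measurableT_comp => //.
by apply: measurable_fun_xsection_finite_kernel; rewrite inE.
Qed.

HB.instance Definition _ := isKernel.Build _ _ _ _ R pair_law
  measurable_pair_law.

Let pair_law_setT u : pair_law u [set: V * V] = 1%E.
Proof. by rewrite /pair_law /= /pushforward preimage_setT prob_kernel. Qed.

HB.instance Definition _ := Kernel_isProbability.Build _ _ _ _ R pair_law
  pair_law_setT.

Let mkcomp_pair_law := mkcomp const_law pair_law.

(** [conditional_law] fixes the law of [(X, Y)] on rectangles only. Uniqueness of measures
    identifies it with the composed kernel, over which integrals are iterated. *)
Lemma conditional_law_integral (h : V * V -> \bar R) :
  conditional_law X Y g -> measurable_fun [set: V * V] h ->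
  (forall z, 0 <= h z)%E ->
  (\int[P]_w h (X w, Y w) = \int[P]_w \int[g (X w)]_y h (X w, y))%E.
Proof.
move=> XY mh h0.
pose Z w := (X w, Y w).
have mZ : measurable_fun [set: Omega] Z by exact: measurable_fun_pair.
have mPZ := @ge0_integral_pushforward _ _ _ _ R Z mZ P setT h measurableT mh
  (fun z _ => h0 z).
rewrite preimage_setT in mPZ; rewrite -[LHS]mPZ.
transitivity (\int[mkcomp_pair_law tt]_z h z)%E; last first.
  rewrite integral_kcomp//; apply: eq_integral => w _.
  have := @ge0_integral_pushforward _ _ _ _ R _ (measurable_pairX (tt, w))
    (g (X w)) setT h measurableT mh (fun z _ => h0 z).
  by rewrite preimage_setT.
apply: eq_measure_integral => S mS _.
(* Measurable rectangles are stable under intersection and generate the product sigma-algebra. *)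
pose G := [set A `*` B | A in @measurable _ V & B in @measurable _ V].
apply: (measure_unique G (fun=> setT)) => //.
- exact: measurable_prod_measurableType.
- move=> _ _ [A1 mA1 [B1 mB1 <-]] [A2 mA2 [B2 mB2 <-]].
  exists (A1 `&` A2); first exact: measurableI.
  by exists (B1 `&` B2); [exact: measurableI|rewrite setXI].
- by move=> _; exists setT => //; exists setT => //; rewrite setXTT.
- by rewrite bigcup_const//; exists 0%N.
- move=> _ [A mA [B mB <-]].
  transitivity (P (X @^-1` A `&` Y @^-1` B)); first by [].
  rewrite XY// integral_mkcond; apply: eq_integral => w _.
  rewrite patchE; case: ifPn => XA.
    rewrite inE /= in XA.
    congr (g (X w) _); apply/seteqP; split => y; [by move=> ?; split|by case].
  (* When [X w] lies outside [A], the section of the rectangle is empty, which matches the integrand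
     extended by zero. *)
  transitivity (g (X w) set0); first by rewrite measure0.
  congr (g (X w) _).
  apply/seteqP; split => y // -[XAw _]; exfalso; move/negP : XA; apply.
  by rewrite inE.
- by move=> k; rewrite /= /pushforward preimage_setT probability_setT ltry.
Qed.

End joint_law.

(** * Moments of the estimator at a fixed point *)

Section moments.
Context {R : realType} {d : nat} (g : estimator R d) (x : 'rV[R]_d).
Hypothesis second_moment_fin : (second_moment g x < +oo)%E.
Local Notation mu := (g x).
Implicit Types v y : 'rV[R]_d.

Lemma measurable_sqr_enorm :
  measurable_fun [set: 'rV[R]_d] (fun y : 'rV[R]_d => enorm y ^+ 2).
Proof.
under eq_fun do rewrite sqr_enorm.
by apply: measurable_dotv => i; exact: measurable_coord.
Qed.

Lemma integrable_sqr_enorm :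
  mu.-integrable [set: 'rV[R]_d] (fun y => (enorm y ^+ 2)%:E).
Proof.
apply/integrableP; split.
  by apply/measurable_EFinP; exact: measurable_sqr_enorm.
under eq_integral do rewrite gee0_abs ?lee_fin ?sqr_ge0//.
exact: second_moment_fin.
Qed.

Lemma integrable_cst_estimator (r : R) :
  mu.-integrable [set: 'rV[R]_d] (fun=> r%:E).
Proof.
apply/integrableP; split; first exact: measurable_cst.
rewrite integral_cst//= prob_kernel mule1; exact: ltry.
Qed.

(** Each coordinate is dominated by [1 + enorm y ^+ 2], which has finite integral. *)
Lemma integrable_coord (i : 'I_d) :
  mu.-integrable [set: 'rV[R]_d] (fun y : 'rV[R]_d => (y 0 i)%:E).
Proof.
apply: (@le_integrable _ _ _ _ _ measurableT _
  (fun y => 1%:E + (enorm y ^+ 2)%:E)%E).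
- by apply/measurable_EFinP; exact: measurable_coord.
- move=> y _; rewrite -EFinD !abse_EFin lee_fin.
  rewrite [leRHS]ger0_norm ?addr_ge0 ?sqr_ge0//.
  rewrite (le_trans (coord_le_enorm y i))//.
  have := sqr_ge0 (enorm y - 1); have := enorm_ge0 y; nra.
- exact: integrableD (integrable_cst_estimator 1) integrable_sqr_enorm.
Qed.

Lemma integral_coord (i : 'I_d) :
  (\int[mu]_y (y 0 i)%:E = (mean g x 0 i)%:E)%E.
Proof.
by rewrite mxE /Rintegral fineK// integrable_fin_num//; exact: integrable_coord.
Qed.

(** Used twice: for the quadratic model of one step, and with [b = 1] to expand the variance. *)
Lemma integral_quadratic (q b : R) v :
  (\int[mu]_y (q + dotv v y + b * enorm y ^+ 2)%:E =
   (q + dotv v (mean g x))%:E + b%:E * second_moment g x)%E.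
Proof.
have int_coordZ i : mu.-integrable [set: 'rV[R]_d]
    (fun y : 'rV[R]_d => (v 0 i)%:E * (y 0 i)%:E)%E.
  by apply: integrableZl => //; exact: integrable_coord.
have int_sum : mu.-integrable [set: 'rV[R]_d]
    (fun y => \sum_(i < d) ((v 0 i)%:E * (y 0 i)%:E))%E.
  exact: integrable_sum.
under eq_integral => y _.
  rewrite 2!EFinD EFinM /dotv -sumEFin.
  under eq_bigr do rewrite EFinM.
  over.
have int_sqr : mu.-integrable [set: 'rV[R]_d]
    (fun y => b%:E * (enorm y ^+ 2)%:E)%E.
  by apply: integrableZl => //; exact: integrable_sqr_enorm.
rewrite integralD//; last first.
  exact: integrableD (integrable_cst_estimator q) int_sum.
rewrite integralD//; last exact: integrable_cst_estimator.
rewrite integral_cst//= prob_kernel mule1.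
rewrite integralZl//; last exact: integrable_sqr_enorm.
rewrite integral_sum// EFinD /dotv -sumEFin; congr (_ + _ + _)%E.
apply: eq_bigr => i _; rewrite integralZl//; last exact: integrable_coord.
by rewrite integral_coord EFinM.
Qed.

(** The variance, the integral of [enorm (y - m) ^+ 2] with [m] the mean, is nonnegative. *)
Lemma sqr_mean_le_second_moment :
  ((enorm (mean g x) ^+ 2)%:E <= second_moment g x)%E.
Proof.
set m := mean g x.
have : (0 <= \int[mu]_y (enorm (y - m) ^+ 2)%:E)%E.
  by apply: integral_ge0 => y _; rewrite lee_fin sqr_ge0.
under eq_integral => y _.
  have -> : enorm (y - m) ^+ 2 =
      enorm m ^+ 2 + dotv (- 2 *: m) y + 1 * enorm y ^+ 2.
    rewrite !sqr_enorm !(dotvDl, dotvDr, dotvNl, dotvNr, dotvZl) (dotvC m y).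
    lra.
  over.
rewrite integral_quadratic mul1e -/m dotvZl -sqr_enorm.
have -> : enorm m ^+ 2 + - 2 * enorm m ^+ 2 = - enorm m ^+ 2 by lra.
by rewrite EFinN addeC sube_ge0.
Qed.

End moments.

(** * Expected descent in one step *)

Section one_step.
Context {R : realType} {d : nat} {d' : measure_display}
  {Omega : measurableType d'} (P : probability Omega R).
Variables (f : 'rV[R]_d -> R) (L m : R) (g : estimator R d) (A B C gamma : R).
Hypotheses (L_gt0 : 0 < L) (f_smooth : smooth L f) (f_ge : forall x, m <= f x).
Hypotheses
  (g_bias : forall x, dotv (grad f x) (mean g x) >= enorm (grad f x) ^+ 2)
  (g_moment : forall x, (second_moment g x <=
    (2 * A * (f x - m) + B * enorm (grad f x) ^+ 2 + C)%:E)%E).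
Hypotheses (gamma_gt0 : 0 < gamma) (LBgamma_le1 : L * B * gamma <= 1)
  (A_ge0 : 0 <= A) (C_ge0 : 0 <= C).
Local Notation V := 'rV[R]_d.

(* The descent inequality shows [model (x, y)] to dominate
   [f (x - gamma *: y) - m], so that it is nonnegative. *)
Let model (z : V * V) : R :=
  f z.1 - m + dotv (- gamma *: grad f z.1) z.2
  + L * gamma ^+ 2 / 2 * enorm z.2 ^+ 2.

Let model_ge x y : f (x - gamma *: y) - m <= model (x, y).
Proof.
have := descent L f x (- (gamma *: y)) L_gt0 f_smooth.
rewrite /model/= dotvZl dotvNr dotvZr !sqr_enorm.
by rewrite dotvNr dotvNl dotvZl dotvZr; lra.
Qed.

Let model_ge0 z : 0 <= model z.
Proof.
case: z => x y; apply: le_trans (model_ge x y).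
by rewrite subr_ge0.
Qed.

Let measurable_model : measurable_fun [set: V * V] (fun z => (model z)%:E).
Proof.
apply/measurable_EFinP; apply: measurable_funD; first apply: measurable_funD.
- apply: measurable_funB; last exact: measurable_cst.
  exact: (measurableT_comp (measurable_smooth L f f_smooth)).
- apply: measurable_dotv => i.
    under eq_fun do rewrite mxE.
    apply: measurable_funM; first exact: measurable_cst.
    exact: (measurableT_comp (measurable_grad_coord L f i f_smooth)).
  exact: (measurableT_comp (measurable_coord i)).
- apply: measurable_funM; first exact: measurable_cst.
  exact: (measurableT_comp measurable_sqr_enorm).
Qed.

(** The bias condition bounds the linear term of the model by [- gamma] times the squared gradient
    norm, and the moment condition bounds its quadratic term. *)
Let integral_model_le x :
  (\int[g x]_y (model (x, y))%:E + (gamma / 2 * enorm (grad f x) ^+ 2)%:E <=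
   ((1 + L * A * gamma ^+ 2) * (f x - m) + L * C * gamma ^+ 2 / 2)%:E)%E.
Proof.
have mom_lty : (second_moment g x < +oo)%E.
  exact: le_lt_trans (g_moment x) (ltry _).
have mom_fin : second_moment g x \is a fin_num.
  rewrite ge0_fin_numE//; apply: integral_ge0 => y _.
  by rewrite lee_fin sqr_ge0.
rewrite /model/=.
rewrite integral_quadratic// dotvZl.
have := g_moment x; rewrite -(fineK mom_fin) -EFinM -!EFinD !lee_fin => mom.
have := g_bias x; have := f_ge x; set q := enorm _ ^+ 2 in mom *.
have q0 : 0 <= q by exact: sqr_ge0.
set M := fine _ in mom *; set D := dotv _ _ => fm qD.
have LgM : L * gamma ^+ 2 / 2 * M <= L * gamma ^+ 2 / 2 *
    (2 * A * (f x - m) + B * q + C).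
  by rewrite ler_wpM2l// mulr_ge0 ?invr_ge0 ?mulr_ge0 ?sqr_ge0// ltW.
have gqD : gamma * q <= gamma * D by rewrite ler_wpM2l// ltW.
(* The [B] part of the second moment consumes at most half of the decrease [gamma * q]; the other
   half remains on the left-hand side. *)
have : (L * B * gamma) * (gamma * q) <= 1 * (gamma * q).
  by rewrite ler_wpM2r// mulr_ge0// ltW.
lra.
Qed.

(** All integrands are nonnegative, so the integrals split in the extended reals even before the
    expectations are known to be finite. *)
Lemma one_step_descent (X X' Y : {RV P >-> V}) :
  conditional_law X Y g -> (forall w, X' w = X w - gamma *: Y w) ->
  (\int[P]_w (f (X' w) - m)%:E
     + (gamma / 2)%:E * \int[P]_w (enorm (grad f (X w)) ^+ 2)%:E <=
   (1 + L * A * gamma ^+ 2)%:E * \int[P]_w (f (X w) - m)%:E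
     + (L * C * gamma ^+ 2 / 2)%:E)%E.
Proof.
move=> XYg X'E.
have mf : measurable_fun [set: V] (fun x => (f x - m)%:E).
  apply/measurable_EFinP; apply: measurable_funB; last exact: measurable_cst.
  exact: measurable_smooth f_smooth.
have mq : measurable_fun [set: Omega] (fun w => (enorm (grad f (X w)) ^+ 2)%:E).
  apply/measurable_EFinP.
  have mgX i : measurable_fun [set: Omega] (fun w => grad f (X w) 0 i).
    exact: (measurableT_comp (measurable_grad_coord L f i f_smooth)).
  under eq_fun do rewrite sqr_enorm.
  exact: measurable_dotv.
have m0 z : (0 <= (model z)%:E)%E by rewrite lee_fin.
have mM : measurable_fun [set: Omega]
    (fun w => \int[g (X w)]_y (model (X w, y))%:E)%E.
  apply: (measurableT_comp (measurable_fun_integral_finite_kernel _ g m0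
    measurable_model)).
  exact: measurable_funP.
have gam20 : 0 <= gamma / 2 by rewrite divr_ge0// ltW.
have a0 : 0 <= 1 + L * A * gamma ^+ 2.
  by rewrite addr_ge0// !mulr_ge0 ?sqr_ge0// ltW.
have c0 : 0 <= L * C * gamma ^+ 2 / 2.
  by rewrite divr_ge0// !mulr_ge0 ?sqr_ge0// ltW.
have f0 x : (0 <= (f x - m)%:E)%E by rewrite lee_fin subr_ge0.
rewrite -ge0_integralZl_EFin//; last by move=> w _; rewrite lee_fin sqr_ge0.
rewrite -ge0_integralZl_EFin//; last exact: (measurableT_comp mf).
(* First [f (X' w) - m] is replaced by its model and the joint law disintegrated; then
   [integral_model_le] applies at each [X w]. *)
apply: (@le_trans _ _ (\int[P]_w \int[g (X w)]_y (model (X w, y))%:E +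
    \int[P]_w ((gamma / 2)%:E * (enorm (grad f (X w)) ^+ 2)%:E))%E).
  rewrite leeD2r//.
  rewrite -(conditional_law_integral P X Y g (fun z => (model z)%:E))//.
  apply: ge0_le_integral => //.
  - exact: (measurableT_comp mf).
  - apply: (measurableT_comp measurable_model).
    by apply: measurable_fun_pair; exact: measurable_funP.
  - by move=> w _; rewrite X'E lee_fin model_ge.
have -> : (L * C * gamma ^+ 2 / 2)%:E =
    (\int[P]_w (L * C * gamma ^+ 2 / 2)%:E)%E.
  by rewrite integral_cst//= probability_setT mule1.
have gq0 w : (0 <= (gamma / 2)%:E * (enorm (grad f (X w)) ^+ 2)%:E)%E.
  by rewrite lee_fin mulr_ge0// sqr_ge0.
have af0 w : (0 <= (1 + L * A * gamma ^+ 2)%:E * (f (X w) - m)%:E)%E.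
  by rewrite lee_fin mulr_ge0// subr_ge0.
have M0 w : (0 <= \int[g (X w)]_y (model (X w, y))%:E)%E.
  by apply: integral_ge0 => y _; exact: m0.
have mfX := measurableT_comp mf (measurable_funP X).
rewrite -ge0_integralD//; last exact: measurable_funeM.
rewrite -ge0_integralD//; last exact: measurable_funeM.
apply: ge0_le_integral => //.
- by move=> w _; apply: adde_ge0.
- by apply: emeasurable_funD => //; exact: measurable_funeM.
- apply: emeasurable_funD => //; exact: measurable_funeM.
- by move=> w _; rewrite -!EFinM -EFinD integral_model_le.
Qed.

End one_step.

(** * Stepsize and recursion *)

(** An elementary substitute for the exponential bound: the right-hand side is at most 3. *)
Lemma exprD1_le (R : realType) (a : R) (n : nat) : 0 <= a -> n%:R * a <= 1 ->
  (1 + a) ^+ n <= 1 + n%:R * a + (n%:R * a) ^+ 2.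
Proof.
move=> a0; elim: n => [|n IH]; first by rewrite expr0 mul0r expr0n/= !addr0.
rewrite -natr1 => na1.
have n0 : 0 <= n%:R :> R by [].
set k := n%:R in IH n0 na1 *.
have ka0 : 0 <= k * a by exact: mulr_ge0.
have ka1 : k * a <= 1 by lra.
rewrite exprS (le_trans (ler_wpM2l _ (IH ka1))) ?addr_ge0//.
(* This absorbs the cubic term [k ^+ 2 * a ^+ 3] of the expanded product. *)
have : 0 <= k * a ^+ 2 * (1 - k * a) by rewrite !mulr_ge0 ?sqr_ge0 ?subr_ge0.
have : 0 <= k * a ^+ 2 by rewrite mulr_ge0 ?sqr_ge0.
have := sqr_ge0 a; lra.
Qed.

Section stepsize.
Context {R : realType}.

(** If [s] were 0 the quotient would be [+oo], which no real number equals. *)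
Lemma eq_dive (gam c s : R) : gam%:E = (c%:E / s%:E)%E -> 0 < c ->
  gam * s = c.
Proof.
move=> + c0; rewrite inver; case: eqP => [s0|/eqP s0].
  by rewrite gt0_muley// lte_fin.
by move=> [->]; rewrite divfK.
Qed.

Lemma dive_lty (c s : R) : 0 < c -> 0 <= s -> (c%:E / s%:E = +oo)%E -> s = 0.
Proof.
by move=> c0 s_ge0; rewrite inver; case: eqP => // /eqP s0.
Qed.

Lemma le_dive (gam c s : R) : 0 < c -> 0 <= s -> (gam%:E <= c%:E / s%:E)%E ->
  gam * s <= c.
Proof.
move=> c0; rewrite inver; case: eqP => [->|/eqP s0 s_ge0].
  by rewrite mulr0 (ltW c0).
by rewrite -EFinM lee_fin ler_pdivlMr// lt_neqAle eq_sym s0.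
Qed.

(** The first three bounds hold because [gam] is below each term of the minimum. The fourth pairs
    the term attaining the minimum with the matching term of the maximum bounding [T]. *)
Lemma stepsize_bounds (L A B C eps delta gam : R) (T : nat) :
  0 < L -> 0 <= A -> 0 <= B -> 0 <= C -> 0 < eps -> 0 <= delta ->
  0 < gam -> gam%:E = stepsize L A B C eps T ->
  12 * delta * L / eps ^+ 2 *
    Num.max B (Num.max (12 * delta * A / eps ^+ 2) (2 * C / eps ^+ 2))
    <= T%:R ->
  [/\ T%:R * (L * A * gam ^+ 2) <= 1, L * B * gam <= 1,
    2 * L * C * gam <= eps ^+ 2 & 12 * delta <= T%:R * gam * eps ^+ 2].
Proof.
move=> L0 A0 B0 C0 eps0 delta0 gam0 gamE T_large.
have L0' := ltW L0; have eps20 : 0 < eps ^+ 2 by exact: exprn_gt0.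
have T0 : 0 <= T%:R :> R by [].
set s := Num.sqrt (L * A * T%:R).
have sE : s ^+ 2 = L * A * T%:R by rewrite sqr_sqrtr// !mulr_ge0.
have s_ge0 : 0 <= s by exact: sqrtr_ge0.
(* The fourth bound becomes [k <= T%:R * gam], and the largeness of [T] becomes [k * L * b <= T%:R]
   for [b] among [B], [k * A] and [2 * C / eps ^+ 2]. *)
pose k := 12 * delta / eps ^+ 2.
have k0 : 0 <= k by rewrite /k divr_ge0 ?sqr_ge0 ?mulr_ge0.
have kE : 12 * delta = k * eps ^+ 2 by rewrite /k divfK// gt_eqF.
have le1 : gam * s <= 1.
  by apply: le_dive; rewrite // gamE /stepsize ge_min lexx.
have le2 : gam * (L * B) <= 1.
  by apply: le_dive; rewrite ?mulr_ge0// gamE /stepsize !ge_min lexx orbT.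
have le3 : gam * (2 * L * C) <= eps ^+ 2.
  by apply: le_dive; rewrite ?mulr_ge0// gamE /stepsize !ge_min lexx !orbT.
split; [|lra|lra|].
  have -> : T%:R * (L * A * gam ^+ 2) = (gam * s) ^+ 2.
    by rewrite exprMn sE; lra.
  by rewrite expr_le1// mulr_ge0// ltW.
rewrite kE ler_pM2r//.
have kL0 : 0 <= k * L by exact: mulr_ge0.
have {}T_large b : b <= Num.max B (Num.max (12 * delta * A / eps ^+ 2)
    (2 * C / eps ^+ 2)) -> k * L * b <= T%:R.
  move=> hb; apply: le_trans (T_large); rewrite [_ * L / _]mulrAC -/k.
  exact: ler_wpM2l.
have [] : [\/ gam * s = 1, gam * (L * B) = 1 | gam * (2 * L * C) = eps ^+ 2].
  move: gamE; rewrite /stepsize -/s; case: leP => [_ /eq_dive ->//|_].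
    by constructor 1.
  case: leP => [_ /eq_dive ->//|_ /eq_dive ->//].
    by constructor 2.
  by constructor 3.
- move=> gs1; have := T_large (12 * delta * A / eps ^+ 2).
  rewrite !le_max lexx orbT [12 * _ * A / _]mulrAC -/k => /(_ isT) kA.
  (* Squared, this reads [k ^+ 2 * L * A * T%:R <= T%:R ^+ 2], which is [kA] times [T%:R]. *)
  have ks : k * s <= T%:R.
    rewrite -(@ler_pXn2r _ 2) ?nnegrE ?(mulr_ge0 k0 s_ge0)// exprMn sE.
    by rewrite [leRHS]expr2; apply: le_trans (ler_wpM2r T0 kA); lra.
  have -> : k = k * s * gam by rewrite -mulrA (mulrC s) gs1 mulr1.
  by rewrite ler_wpM2r// ltW.
- move=> gs1; have := T_large B; rewrite !le_max lexx => /(_ isT) kB.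
  have -> : k = k * L * B * gam by rewrite -[LHS]mulr1 -gs1; lra.
  by rewrite ler_wpM2r// ltW.
- move=> gs1; have := T_large (2 * C / eps ^+ 2).
  rewrite !le_max lexx !orbT => /(_ isT) kC.
  have -> : k = k * L * (2 * C / eps ^+ 2) * gam.
    have -> : k * L * (2 * C / eps ^+ 2) * gam =
        k * (gam * (2 * L * C)) / eps ^+ 2 by lra.
    by rewrite gs1 mulfK// lt0r_neq0.
  by rewrite ler_wpM2r// ltW.
Qed.

End stepsize.

Lemma exists_le_of_recursion (R : realType) (D Q : nat -> \bar R)
  (a c h q delta : R) (T : nat) :
  (0 < T)%N -> 0 <= a -> T%:R * a <= 1 -> 0 < h -> 0 <= q -> 0 <= delta ->
  (forall t, (0 <= D t)%E) -> D 0%N = delta%:E ->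
  (forall t, (D t.+1 + h%:E * Q t <= (1 + a)%:E * D t + c%:E)%E) ->
  c <= h * q / 2 -> 3 * delta <= T%:R * (h * q / 2) ->
  exists2 t, (t < T)%N & (Q t <= q%:E)%E.
Proof.
case: T => [//|n] _ a0 Ta h0 q0 delta0 D0 DE rec; set b := h * q / 2 => cb Tb.
have b0 : 0 <= b by rewrite /b divr_ge0// mulr_ge0// ltW.
have hqE : h * q = b + b by rewrite /b; lra.
clearbody b.
apply: contrapT => noQ.
have Q_gt t : (t < n.+1)%N -> (q%:E < Q t)%E.
  by move=> tn; rewrite ltNge; apply/negP => Qt; apply: noQ; exists t.
(* The induction carries finiteness of [D t] along with the bound. Each step gains [h * q = b + b]
   and loses [c <= b], a net decrease of [b]. *)
have DrE t : (t <= n)%N ->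
    exists2 r, D t = r%:E & r + t%:R * b <= (1 + a) ^+ t * delta.
  elim: t => [_|t IH tn].
    by exists delta => //; rewrite mul0r addr0 expr0 mul1r.
  have [r Dr rb] := IH (ltnW tn).
  have Dt : (D t.+1 + (h * q)%:E <= ((1 + a) * r + c)%:E)%E.
    rewrite EFinD [((1 + a) * r)%:E]EFinM -Dr; apply: le_trans (rec t).
    rewrite leeD2l// EFinM.
    by rewrite lee_pmul2l//= ltW// Q_gt// ltnW.
  have := D0 t.+1; case: (D t.+1) Dt => [r'|//|//].
  rewrite -EFinD lee_fin hqE => r'_le _; exists r' => //.
  have : (1 + a) * (r + t%:R * b) <= (1 + a) ^+ t.+1 * delta.
    by rewrite exprS -mulrA ler_wpM2l// addr_ge0.
  have : 0 <= a * (t%:R * b) by rewrite !mulr_ge0.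
  rewrite -natr1; lra.
have [r Dr rb] := DrE n (leqnn n).
apply: noQ; exists n => //.
(* At the last index [n = T - 1], nonnegativity of [D n.+1] leaves at most
   [3 * delta - n%:R * b + b <= b + b] for [h * Q n], contradicting [Q n > q]. *)
have hQ : (h%:E * Q n <= (h * q)%:E)%E.
  apply: (@le_trans _ _ (D n.+1 + h%:E * Q n)%E); first by rewrite leeDr.
  apply: le_trans (rec n) _; rewrite Dr -EFinM -EFinD lee_fin hqE.
  have : (1 + a) * (r + n%:R * b) <= (1 + a) ^+ n.+1 * delta.
    by rewrite exprS -mulrA ler_wpM2l// addr_ge0.
  have : 0 <= a * (n%:R * b) by rewrite !mulr_ge0.
  have le3 : (1 + a) ^+ n.+1 <= 3.
    apply: le_trans (exprD1_le _ _ _ a0 Ta) _.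
    have : (n.+1%:R * a) ^+ 2 <= 1 by rewrite expr_le1// mulr_ge0.
    lra.
  have : (1 + a) ^+ n.+1 * delta <= 3 * delta by exact: ler_wpM2r.
  move: Tb; rewrite -natr1; lra.
by move: hQ; rewrite EFinM lee_pmul2l.
Qed.

(** * From the recursion to the expected gradient norm *)

Theorem corollary6 (R : realType) (d : nat)
  (f : 'rV[R]_d -> R) (L fstar : R)
  (f_smooth : smooth L f)
  (f_bounded : forall x, fstar <= f x)
  (g : estimator R d) (A B C : R)
  (A_ge0 : 0 <= A) (B_ge0 : 0 <= B) (C_ge0 : 0 <= C)
  (g_bias : forall x, dotv (grad f x) (mean g x) >= enorm (grad f x) ^+ 2)
  (g_moment : forall x, (second_moment g x <=
    (2 * A * (f x - fstar) + B * enorm (grad f x) ^+ 2 + C)%:E)%E)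
  (x0 : 'rV[R]_d) (delta0 : R) (delta0E : delta0 = f x0 - fstar)
  (eps : R) (eps_gt0 : 0 < eps)
  (T : nat) (T_ge1 : (1 <= T)%N)
  (gamma : R) (gamma_gt0 : 0 < gamma)
  (gammaE : (stepsize L A B C eps T < +oo)%E ->
    gamma%:E = stepsize L A B C eps T)
  (T_large : T%:R >= 12 * delta0 * L / eps ^+ 2 *
    Num.max B (Num.max (12 * delta0 * A / eps ^+ 2) (2 * C / eps ^+ 2)))
  (d' : measure_display) (Omega : measurableType d')
  (P : probability Omega R)
  (x gt : nat -> {RV P >-> 'rV[R]_d})
  (sgd : BiasedSGD g gamma x0 x gt) :
  (\big[mine/+oo]_(t < T) 'E_P[fun w => enorm (grad f (x t w))] <= eps%:E)%E.
Proof.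
have grad0_done : (forall y, grad f y = 0) ->
    (\big[mine/+oo]_(t < T) 'E_P[fun w => enorm (grad f (x t w))] <= eps%:E)%E.
  move=> g0; apply: (bigmin_inf (Ordinal T_ge1)) => //.
  rewrite unlock; under eq_integral do rewrite g0 enorm0.
  by rewrite integral0 lee_fin ltW.
have [L_le0|L_gt0] := leP L 0.
  by apply: grad0_done => y; exact: grad_smooth_le0 L_le0 f_smooth f_bounded.
have delta0_ge0 : 0 <= delta0 by rewrite delta0E subr_ge0.
have eps2_gt0 : 0 < eps ^+ 2 by exact: exprn_gt0.
have [step_fin|] := ltP (stepsize L A B C eps T) +oo%E; last first.
  rewrite leye_eq => /eqP step_oo; apply: grad0_done => y.
  have [LAT LB LC] :
      [/\ Num.sqrt (L * A * T%:R) = 0, L * B = 0 & 2 * L * C = 0].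
    move: step_oo; rewrite /stepsize => /eqP.
    rewrite -leye_eq !le_min !leye_eq => /and3P[/eqP h1 /eqP h2 /eqP h3].
    split.
    + by apply: dive_lty h1 => //; exact: sqrtr_ge0.
    + by apply: dive_lty h2; rewrite ?mulr_ge0// ltW.
    + by apply: dive_lty h3; rewrite ?mulr_ge0// ltW.
  have A0 : A = 0.
    have LT : 0 < L * T%:R by rewrite mulr_gt0// ltr0n.
    move/eqP: LAT; rewrite sqrtr_eq0 => LAT.
    apply/eqP; rewrite eq_le A_ge0 andbT.
    by rewrite -(pmulr_rle0 _ LT) mulrAC.
  have B0 : B = 0 by move/eqP: LB; rewrite mulf_eq0 gt_eqF//= => /eqP.
  have C0 : C = 0.
    by move/eqP: LC; rewrite !mulf_eq0 pnatr_eq0 /= (gt_eqF L_gt0) /= => /eqP.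
  (* With [A = B = C = 0] the second moment vanishes, hence so does the mean, and the bias condition
     forces [grad f y = 0]. *)
  have sm0 : (second_moment g y <= 0)%E.
    by apply: le_trans (g_moment y) _; rewrite A0 B0 C0 mulr0 !mul0r !addr0.
  have mean0 : enorm (mean g y) ^+ 2 <= 0.
    rewrite -lee_fin; apply: (le_trans _ sm0).
    by apply: sqr_mean_le_second_moment; exact: le_lt_trans sm0 (ltry 0).
  apply: sqr_enorm_le0; apply: le_trans (g_bias y) _.
  rewrite (sqr_enorm_le0 _ mean0) /dotv big1// => i _.
  by rewrite [X in _ * X]mxE mulr0.
have [Tgam LBgam LCgam Teps] := stepsize_bounds _ _ _ _ _ _ _ _ L_gt0 A_ge0
  B_ge0 C_ge0 eps_gt0 delta0_ge0 gamma_gt0 (gammaE step_fin) T_large.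
have [x_0 xS xg] := sgd.
pose D t := (\int[P]_w (f (x t w) - fstar)%:E)%E.
pose Q t := (\int[P]_w (enorm (grad f (x t w)) ^+ 2)%:E)%E.
have [t tT Qt] : exists2 t, (t < T)%N & (Q t <= (eps ^+ 2)%:E)%E.
  (* With [h = gamma / 2] and [q = eps ^+ 2], the threshold [h * q / 2] is [gamma * eps ^+ 2 / 4];
     the last two side conditions then follow from [LCgam] and [Teps]. *)
  apply: (exists_le_of_recursion _ D Q (L * A * gamma ^+ 2)
    (L * C * gamma ^+ 2 / 2) (gamma / 2) _ delta0) => //.
  - by rewrite !mulr_ge0 ?sqr_ge0// ltW.
  - by rewrite divr_gt0.
  - by rewrite sqr_ge0.
  - by move=> t; apply: integral_ge0 => w _; rewrite lee_fin subr_ge0.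
  - rewrite /D; under eq_integral do rewrite x_0 -delta0E.
    by rewrite integral_cst//= probability_setT mule1.
  - move=> t; exact: (one_step_descent P f L fstar g A B C gamma L_gt0 f_smooth
      f_bounded g_bias g_moment gamma_gt0 LBgam A_ge0 C_ge0
      _ _ _ (xg t) (xS t)).
  - have : (2 * L * C * gamma) * gamma <= eps ^+ 2 * gamma.
      by rewrite ler_wpM2r// ltW.
    lra.
  - lra.
apply: (bigmin_inf (Ordinal tT)) => //=.
have mq i : measurable_fun [set: Omega] (fun w => grad f (x t w) 0 i).
  exact: (measurableT_comp (measurable_grad_coord L f i f_smooth)).
have mg : measurable_fun [set: Omega] (fun w => (enorm (grad f (x t w)))%:E).
  apply/measurable_EFinP.
  apply: (measurableT_comp (continuous_measurable_fun (@sqrt_continuous R))).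
  exact: measurable_dotv.
have mg2 : measurable_fun [set: Omega]
    (fun w => (enorm (grad f (x t w)) ^+ 2)%:E).
  apply/measurable_EFinP; under eq_fun do rewrite sqr_enorm.
  exact: measurable_dotv.
have e2 : 0 <= (2 * eps)^-1 by rewrite invr_ge0 mulr_ge0// ltW.
have e2_ge0 : 0 <= eps / 2 by rewrite divr_ge0// ltW.
rewrite unlock.
(* AM-GM: [|v| <= |v|^2 / (2 eps) + eps / 2]. *)
apply: (@le_trans _ _ (\int[P]_w (((2 * eps)^-1)%:E *
    (enorm (grad f (x t w)) ^+ 2)%:E + (eps / 2)%:E))%E).
  apply: ge0_le_integral => //.
  - by move=> w _; rewrite lee_fin enorm_ge0.
  - apply: emeasurable_funD => //; exact: measurable_funeM.
  - move=> w _; rewrite -EFinM -EFinD lee_fin.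
    set q := enorm _; have := sqr_ge0 (q - eps).
    have -> : eps / 2 = (2 * eps)^-1 * eps ^+ 2 by field; lra.
    rewrite -mulrDr ler_pdivlMl; lra.
rewrite ge0_integralD//; last 2 first.
  by move=> w _; rewrite -EFinM lee_fin mulr_ge0// sqr_ge0.
  exact: measurable_funeM.
rewrite ge0_integralZl_EFin//; last by move=> w _; rewrite lee_fin sqr_ge0.
rewrite integral_cst//= probability_setT mule1.
apply: (@le_trans _ _ (((2 * eps)^-1)%:E * (eps ^+ 2)%:E + (eps / 2)%:E)%E).
  by rewrite leeD2r// lee_wpmul2l.
rewrite -EFinM -EFinD lee_fin.
by have -> : (2 * eps)^-1 * eps ^+ 2 + eps / 2 = eps by field; lra.
Qed.
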